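(* Let $n\ge3$ and let $g_0$ be a complete, smoothly conformally compact asymptotically hyperbolic, rotationally symmetric metric on $\mathbb{R}^n$ whose sectional curvature in 2-planes tangent to the orbits of rotational symmetry satisfies $\lambda(g_0)\le0$ everywhere. Then $(\mathbb{R}^n,g_0)$ contains no closed minimal hypersurfaces.
   Context: A metric on $\mathbb{R}^n$ is rotationally symmetric if it is invariant under the standard action of $SO(n)$ fixing the origin. $\lambda(g)$ denotes the sectional curvature of $g$ in 2-planes tangent to the $SO(n)$-orbits (extended to the origin by continuity). ''Closed'' means compact without boundary. $(\mathbb{R}^n,g)$ is (smoothly) conformally compact and asymptotically hyperbolic if $\mathbb{R}^n$ is identified with the interior of a smooth compact manifold-with-boundary $M$ and there is a smooth boundary defining function $\Omega:M\to[0,\infty)$ (vanishing precisely on $\partial M$, to first order) such that $\Omega^2g$ extends to a smooth Riemannian metric on $M$ and $|d\Omega|^2_{\Omega^2g}=1$ on $\partial M$. *)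

(* Defs.v *)
From HB Require Import structures.
From mathcomp Require Import all_boot all_order all_algebra.
From mathcomp Require Import all_classical all_reals all_analysis.

Set Implicit Arguments.
Unset Strict Implicit.
Unset Printing Implicit Defensive.

Import Order.TTheory GRing.Theory Num.Theory.
Import numFieldNormedType.Exports.

Local Open Scope classical_set_scope.
Local Open Scope ring_scope.

(* Points and tangent vectors of R^n are row vectors, so linear maps act on   *)
(* the right: the differential of f at p sends v to v *m 'J f p.              *)

Section Smooth.
Variable R : realType.

Definition pderiv n (i : 'I_n) (f : 'rV[R]_n -> R) (x : 'rV[R]_n) : R :=
  'D_(delta_mx 0 i) f x.

Definition pderivs n (s : seq 'I_n) (f : 'rV[R]_n -> R) : 'rV[R]_n -> R :=
  foldr (@pderiv n) f s.

(* Meant for open U: all partial derivatives of all orders are (Frechet)      *)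
(* differentiable, i.e. f is C^oo on U.                                       *)
Definition smooth_open n (U : set 'rV[R]_n) (f : 'rV[R]_n -> R) : Prop :=
  forall (s : seq 'I_n) x, U x -> differentiable (pderivs s f) x.

(* h extends f smoothly from A to a neighbourhood U of x. *)
Definition local_extension n (A : set 'rV[R]_n) (f : 'rV[R]_n -> R)
    (x : 'rV[R]_n) (U : set 'rV[R]_n) (h : 'rV[R]_n -> R) : Prop :=
  [/\ open U, U x, smooth_open U h & forall y, U y -> A y -> h y = f y].

(* Smoothness on an arbitrary set A, typically a relatively open subset of a  *)
(* half-space; for A open this is the usual notion.                           *)
Definition smooth_on n (A : set 'rV[R]_n) (f : 'rV[R]_n -> R) : Prop :=
  forall x, A x -> exists U h, local_extension A f x U h.

Definition smooth_mx_on n p q (A : set 'rV[R]_n)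
    (f : 'rV[R]_n -> 'M[R]_(p, q)) : Prop :=
  forall i j, smooth_on A (fun x => f x i j).

(* d lists the partial derivatives at x of the restriction of f to A. They    *)
(* are read off a smooth extension because 'D_v f x would also depend on the  *)
(* values of f outside A; when A is relatively open in a half-space, d does   *)
(* not depend on the extension.                                               *)
Definition differential_on n (A : set 'rV[R]_n) (f : 'rV[R]_n -> R)
    (x d : 'rV[R]_n) : Prop :=
  exists U h, local_extension A f x U h /\ d = \row_i pderiv i h x.

End Smooth.

Section Manifolds.
Variable R : realType.

Definition half_space n : set 'rV[R]_n :=
  [set x | forall i : 'I_n, val i = 0%N -> 0 <= x 0 i].

Record chart (n : nat) (M : topologicalType) := Chart {
  cdom : set M;
  cmap : M -> 'rV[R]_n;
  cinv : 'rV[R]_n -> M }.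

Definition cimg n M (c : chart n M) : set 'rV[R]_n := cmap c @` cdom c.

Definition is_chart n M (c : chart n M) : Prop :=
  [/\ open (cdom c),
      exists2 V : set 'rV[R]_n, open V & cimg c = V `&` @half_space n,
      forall p, cdom c p -> cinv c (cmap c p) = p,
      {within cdom c, continuous (cmap c)} &
      {within cimg c, continuous (cinv c)}].

Definition manifold_with_boundary n M (A : set (chart n M)) : Prop :=
  [/\ hausdorff_space M,
      @second_countable M,
      forall c, A c -> is_chart c,
      forall p, exists2 c, A c & cdom c p &
      forall c d, A c -> A d ->
        smooth_mx_on (cmap c @` (cdom c `&` cdom d)) (cmap d \o cinv c)].

Definition bdry n M (A : set (chart n M)) : set M :=
  [set p | exists c (i : 'I_n),
     [/\ A c, cdom c p, val i = 0%N & cmap c p 0 i = 0]].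

(* iota is a diffeomorphism from R^n onto the interior of M, with inverse     *)
(* rho; the values of rho on the boundary are irrelevant.                     *)
Definition interior_diffeo n M (A : set (chart n M))
    (iota : 'rV[R]_n -> M) (rho : M -> 'rV[R]_n) : Prop :=
  [/\ cancel iota rho,
      range iota = ~` bdry A,
      continuous iota,
      forall c, A c -> smooth_mx_on (iota @^-1` cdom c) (cmap c \o iota) &
      forall c, A c ->
        smooth_mx_on (cmap c @` (cdom c `\` bdry A)) (rho \o cinv c)].

Definition boundary_defining n M (A : set (chart n M)) (Om : M -> R) : Prop :=
  [/\ forall c, A c -> smooth_on (cimg c) (Om \o cinv c),
      forall p, 0 <= Om p,
      forall p, Om p = 0 <-> bdry A p &
      forall c p, A c -> cdom c p -> bdry A p ->
        exists2 d, differential_on (cimg c) (Om \o cinv c) (cmap c p) d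
                 & d != 0].

End Manifolds.

Section Metrics.
Variable R : realType.

Definition inner n (G : 'M[R]_n) (u v : 'rV[R]_n) : R := (u *m G *m v^T) 0 0.

Definition inner_product n (G : 'M[R]_n) : Prop :=
  G^T = G /\ forall u : 'rV[R]_n, u != 0 -> 0 < inner G u u.

Definition riemannian_metric n (g : 'rV[R]_n -> 'M[R]_n) : Prop :=
  smooth_mx_on setT g /\ forall x, inner_product (g x).

Definition rotationally_symmetric n (g : 'rV[R]_n -> 'M[R]_n) : Prop :=
  forall A : 'M[R]_n, A *m A^T = 1%:M -> \det A = 1 ->
  forall x, A *m g (x *m A) *m A^T = g x.

Definition christoffel n (g : 'rV[R]_n -> 'M[R]_n) (k i j : 'I_n)
    (x : 'rV[R]_n) : R :=
  2^-1 * \sum_l invmx (g x) k l *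
    (pderiv i (fun y => g y j l) x + pderiv j (fun y => g y i l) x
     - pderiv l (fun y => g y i j) x).

(* The l-th component of R(e_i, e_j) e_k, for the sign convention             *)
(* R(X, Y) Z = D_X D_Y Z - D_Y D_X Z - D_[X, Y] Z.                            *)
Definition riemann n (g : 'rV[R]_n -> 'M[R]_n) (l i j k : 'I_n)
    (x : 'rV[R]_n) : R :=
  pderiv i (christoffel g l j k) x - pderiv j (christoffel g l i k) x
  + \sum_m (christoffel g l i m x * christoffel g m j k x
            - christoffel g l j m x * christoffel g m i k x).

Definition sectional_curvature n (g : 'rV[R]_n -> 'M[R]_n)
    (x u v : 'rV[R]_n) : R :=
  let Ruvv := \row_l \sum_i \sum_j \sum_k
                riemann g l i j k x * u 0 i * v 0 j * v 0 k in
  inner (g x) Ruvv u /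
  (inner (g x) u u * inner (g x) v v - inner (g x) u v ^+ 2).

(* The tangent space at x of the SO(n)-orbit of x: the values at x of the     *)
(* vector fields generated by the Lie algebra so(n). It is 0 at the origin.   *)
Definition orbit_tangent n (x u : 'rV[R]_n) : Prop :=
  exists2 A : 'M[R]_n, A^T = - A & u = x *m A.

(* lam is the curvature of the 2-planes tangent to the orbits. The second     *)
(* clause only concerns x != 0, and the first one then determines lam 0.      *)
Definition orbit_curvature n (g : 'rV[R]_n -> 'M[R]_n)
    (lam : 'rV[R]_n -> R) : Prop :=
  continuous lam /\
  forall x u v, orbit_tangent x u -> orbit_tangent x v ->
    row_free (col_mx u v) -> lam x = sectional_curvature g x u v.

Definition geodesic n (g : 'rV[R]_n -> 'M[R]_n) (c : R -> 'rV[R]_n) : Prop :=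
  forall t, [/\ derivable c t 1, derivable (derive1 c) t 1 &
    forall k, derive1 (derive1 c) t 0 k =
      - \sum_i \sum_j
          christoffel g k i j (c t) * derive1 c t 0 i * derive1 c t 0 j].

(* Geodesic completeness. *)
Definition complete_metric n (g : 'rV[R]_n -> 'M[R]_n) : Prop :=
  forall x v, exists c, [/\ geodesic g c, c 0 = x & derive1 c 0 = v].

(* G c is the matrix of the extension of Om^2 g in the chart c. The           *)
(* change-of-chart law needs no clause of its own: it holds on the interior,  *)
(* where every G c is computed from g, hence on the boundary by continuity.   *)
Definition conformal_extension n (M : topologicalType) (A : set (chart R n M))
    (iota : 'rV[R]_n -> M) (Om : M -> R) (g : 'rV[R]_n -> 'M[R]_n)
    (G : chart R n M -> 'rV[R]_n -> 'M[R]_n) : Prop :=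
  forall c, A c ->
  [/\ smooth_mx_on (cimg c) (G c),
      forall y, cimg c y -> inner_product (G c y) &
      forall x, cdom c (iota x) ->
        let J := 'J (cmap c \o iota) x in
        Om (iota x) ^+ 2 *: g x = J *m G c (cmap c (iota x)) *m J^T].

Definition conformally_compact_AH n (g : 'rV[R]_n -> 'M[R]_n) : Prop :=
  exists (M : topologicalType) (A : set (chart R n M))
    (iota : 'rV[R]_n -> M) (rho : M -> 'rV[R]_n) (Om : M -> R)
    (G : chart R n M -> 'rV[R]_n -> 'M[R]_n),
  [/\ manifold_with_boundary A /\ compact [set: M],
      interior_diffeo A iota rho,
      boundary_defining A Om,
      conformal_extension A iota Om g G &
      forall c p, A c -> cdom c p -> bdry A p ->
        exists2 d, differential_on (cimg c) (Om \o cinv c) (cmap c p) d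
                 & inner (invmx (G c (cmap c p))) d d = 1].

(* Mean curvature at psi y, with respect to nu, of the parametrized           *)
(* hypersurface psi: the trace, for the induced metric h, of the second       *)
(* fundamental form II_ab = g(D_(d_a psi) (d_b psi), nu).                     *)
Definition mean_curvature m n (g : 'rV[R]_n -> 'M[R]_n)
    (psi : 'rV[R]_m -> 'rV[R]_n) (y : 'rV[R]_m) (nu : 'rV[R]_n) : R :=
  let J := 'J psi y in
  let h := J *m g (psi y) *m J^T in
  let II a b := inner (g (psi y))
    (\row_k (pderiv a (pderiv b (fun z => psi z 0 k)) y
             + \sum_i \sum_j christoffel g k i j (psi y) * J a i * J b j)) nu in
  \sum_a \sum_b invmx h a b * II a b.

Definition unit_normal m n (g : 'rV[R]_n -> 'M[R]_n)
    (psi : 'rV[R]_m -> 'rV[R]_n) (y : 'rV[R]_m) (nu : 'rV[R]_n) : Prop :=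
  inner (g (psi y)) nu nu = 1 /\
  forall a, inner (g (psi y)) (row a ('J psi y)) nu = 0.

(* F immerses the nonempty closed (n-1)-manifold S in R^n with vanishing mean *)
(* curvature; F is not required to be injective, so embedded hypersurfaces    *)
(* are the case where F is an inclusion.                                      *)
Definition closed_minimal_hypersurface n (g : 'rV[R]_n -> 'M[R]_n)
    (S : topologicalType) (A : set (chart R n.-1 S)) (F : S -> 'rV[R]_n)
    : Prop :=
  [/\ manifold_with_boundary A,
      [/\ compact [set: S], bdry A = set0 & [set: S] !=set0],
      forall c, A c -> smooth_mx_on (cimg c) (F \o cinv c),
      forall c y, A c -> cimg c y -> \rank ('J (F \o cinv c) y) = n.-1 &
      forall c y nu, A c -> cimg c y -> unit_normal g (F \o cinv c) y nu ->
        mean_curvature g (F \o cinv c) y nu = 0].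

End Metrics.

(* Main.v *)
Require Import Defs.
From mathcomp Require Import all_boot all_order all_algebra.
From mathcomp Require Import all_classical all_reals all_analysis.
From mathcomp Require Import fingroup perm ring lra.
Import Order.TTheory GRing.Theory Num.Theory.
Import numFieldNormedType.Exports.
Local Open Scope classical_set_scope.
Local Open Scope ring_scope.

Set Implicit Arguments.
Unset Strict Implicit.
Unset Printing Implicit Defensive.

(** Rotational symmetry gives the metric at [x != 0] the form
    [phi s * I + psi s * x^T x] with [s = sqnorm x] ([metric_radial_form]): the
    sphere through [x] has squared area radius [s * phi s], and
    [phi s + s * psi s] is the squared length of the Euclidean unit radial vector. A
    computation of the Riemann tensor on a coordinate axis shows that the planes
    tangent to this sphere have nonpositive curvature exactly when
    [phi s * (phi s + s * psi s) <= (phi s + s * phi' s) ^ 2]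
    ([curvature_le0_axis]). The left-hand side is positive, so the derivative
    [phi s + s * phi' s] of the squared area radius never vanishes; it is
    positive at the origin, hence everywhere ([area_radius_increasing]). This
    makes all the spheres around the origin strictly mean convex
    ([spheres_mean_convex]).

    A closed hypersurface has a point farthest from the origin. There it is
    tangent to a sphere and lies inside it, so it is at least as curved as that
    sphere: tracing the second derivative test for [sqnorm] against the inverse
    of the induced metric shows that its mean curvature cannot be zero
    ([no_minimal_touching]). *)

(** * Euclidean geometry and rotations *)

Definition dot (R : realType) (n : nat) (u v : 'rV[R]_n) : R :=
  \sum_i u 0 i * v 0 i.

Notation sqnorm u := (dot u u).

Section Euclidean.
Context {R : realType} {n : nat}.
Implicit Types (u v w x : 'rV[R]_n) (A Q : 'M[R]_n).

Lemma dotE u v : dot u v = (u *m v^T) 0 0.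
Proof. by rewrite mxE; apply: eq_bigr => i _; rewrite mxE. Qed.

Lemma dotC u v : dot u v = dot v u.
Proof. by apply: eq_bigr => i _; rewrite mulrC. Qed.

Lemma dotDr u v w : dot u (v + w) = dot u v + dot u w.
Proof. by rewrite -big_split; apply: eq_bigr => i _; rewrite mxE mulrDr. Qed.

Lemma dotBr u v w : dot u (v - w) = dot u v - dot u w.
Proof. by rewrite -sumrB; apply: eq_bigr => i _; rewrite !mxE mulrBr. Qed.

Lemma dotZr a u v : dot u (a *: v) = a * dot u v.
Proof. by rewrite mulr_sumr; apply: eq_bigr => i _; rewrite mxE mulrCA. Qed.

Lemma dotZl a u v : dot (a *: u) v = a * dot u v.
Proof. by rewrite dotC dotZr dotC. Qed.

Lemma sqnorm_ge0 u : 0 <= sqnorm u.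
Proof. by apply: sumr_ge0 => i _; rewrite -expr2 sqr_ge0. Qed.

Lemma sqnorm_eq0 u : (sqnorm u == 0) = (u == 0).
Proof.
rewrite psumr_eq0 => [|i _]; last by rewrite -expr2 sqr_ge0.
apply/allP/eqP => [h|-> i _] /=; last by rewrite mxE mul0r eqxx.
apply/rowP => i; rewrite mxE.
by have /= := h i (mem_index_enum _); rewrite mulf_eq0 orbb => /eqP.
Qed.

Lemma sqnorm_gt0 u : (0 < sqnorm u) = (u != 0).
Proof. by rewrite lt_def sqnorm_ge0 andbT sqnorm_eq0. Qed.

Lemma dot_deltal i u : dot (delta_mx 0 i) u = u 0 i.
Proof.
rewrite /dot (bigD1 i) //= big1 ?addr0 => [|k /negPf ki].
  by rewrite !mxE !eqxx mul1r.
by rewrite !mxE ki mul0r.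
Qed.

Lemma dot_delta i j :
  dot (delta_mx 0 i : 'rV[R]_n) (delta_mx 0 j) = (i == j)%:R.
Proof. by rewrite dot_deltal mxE eqxx. Qed.

Lemma sqnorm_axis (r : R) i : sqnorm (r *: delta_mx 0 i : 'rV[R]_n) = r ^+ 2.
Proof. by rewrite dotZl dotZr dot_delta eqxx mulr1 expr2. Qed.

Lemma inner_scalar_rank1 a b u v x :
  inner (a%:M + b *: (x^T *m x)) u v = a * dot u v + b * dot u x * dot x v.
Proof.
rewrite /inner mulmxDr mulmxDl mxE mul_mx_scalar -scalemxAl [X in X + _]mxE -dotE.
rewrite -scalemxAr -scalemxAl [X in _ + X]mxE (mulmxA u) -(mulmxA (u *m x^T)).
rewrite [u *m x^T]mx11_scalar [x *m v^T]mx11_scalar -!dotE -scalar_mxM mxE mulr1n.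
by rewrite mulrA.
Qed.

Lemma inner_delta A i j : inner A (delta_mx 0 i) (delta_mx 0 j) = A i j.
Proof.
rewrite /inner -rowE mxE (bigD1 j) //= big1 => [|k /negPf kj].
  by rewrite !mxE !eqxx mulr1 addr0.
by rewrite !mxE kj mulr0.
Qed.

Lemma inner_congr m (Q : 'M[R]_(m, n)) A (u v : 'rV[R]_m) :
  inner (Q *m A *m Q^T) u v = inner A (u *m Q) (v *m Q).
Proof. by rewrite /inner trmx_mul !mulmxA. Qed.

Lemma inner_scale A a b u v : inner A (a *: u) (b *: v) = a * b * inner A u v.
Proof.
by rewrite /inner linearZ /= -!scalemxAl -scalemxAr !mxE mulrA.
Qed.

Definition flip (i : 'I_n) : 'M[R]_n :=
  diag_mx (\row_k (if k == i then -1 else 1)).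

Lemma det_flip i : \det (flip i) = -1.
Proof.
rewrite det_diag (bigD1 i) //= big1 => [|k /negPf ki]; rewrite mxE ?ki //.
by rewrite eqxx mulr1.
Qed.

Lemma flip_orthogonal i : flip i *m (flip i)^T = 1%:M.
Proof.
rewrite tr_diag_mx; apply/matrixP => k l; rewrite mul_diag_mx !mxE.
by case: (k == i); case: (k == l); rewrite /= ?mulr1n ?mulr0n ?mulr0 ?mulr1 ?mulrNN ?mulr1.
Qed.

Lemma delta_flip i k : delta_mx 0 k *m flip i =
  (if k == i then -1 else 1) *: delta_mx 0 k :> 'rV[R]_n.
Proof.
rewrite -rowE; apply/rowP => j; rewrite !mxE eqxx /= (eq_sym k j).
by have [_|_] := eqVneq j k; rewrite ?mulr1n ?mulr1 // mulr0n mulr0.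
Qed.

Definition quarter_turn (i j : 'I_n) : 'M[R]_n :=
  flip i *m perm_mx (tperm i j).

Lemma quarter_turn_orthogonal i j :
  quarter_turn i j *m (quarter_turn i j)^T = 1%:M.
Proof.
rewrite trmx_mul mulmxA -[X in X *m _]mulmxA tr_perm_mx -perm_mxM mulgV perm_mx1.
by rewrite mulmx1 flip_orthogonal.
Qed.

Lemma det_quarter_turn i j : i != j -> \det (quarter_turn i j) = 1.
Proof.
by move=> ij; rewrite det_mulmx det_flip det_perm odd_tperm ij expr1 mulrNN mulr1.
Qed.

Lemma delta_quarter_turn i j k : delta_mx 0 k *m quarter_turn i j =
  (if k == i then -1 else 1) *: delta_mx 0 (tperm i j k) :> 'rV[R]_n.
Proof.
rewrite mulmxA delta_flip -scalemxAl; congr (_ *: _).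
by rewrite -rowE; apply/rowP => l; rewrite !mxE eqxx eq_sym.
Qed.

(** A Householder reflection maps [r *: e_i] to [x]; when its determinant is
    [-1], flipping another axis first corrects the orientation. *)
Lemma rotation_from_axis x i j : i != j ->
  exists A, [/\ A *m A^T = 1%:M, \det A = 1 &
    Num.sqrt (sqnorm x) *: delta_mx 0 i *m A = x].
Proof.
move=> ij; set r := Num.sqrt _; set y : 'rV[R]_n := r *: _.
have rr : r ^+ 2 = sqnorm x by rewrite sqr_sqrtr ?sqnorm_ge0.
have yy : sqnorm y = sqnorm x by rewrite sqnorm_axis.
have [yx|yx] := eqVneq y x.
  by exists 1%:M; split; rewrite ?trmx1 ?mulmx1 ?det1.
pose w := y - x.
have w0 : sqnorm w != 0 by rewrite sqnorm_eq0 subr_eq0.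
have ww2 : sqnorm w = 2 * dot y w.
  by rewrite /w dotBr !(dotC (y - x)) !dotBr yy (dotC x y); ring.
pose H : 'M[R]_n := 1%:M - (2 / sqnorm w) *: (w^T *m w).
have HT : H^T = H.
  by rewrite /H linearB /= trmx1 linearZ /= trmx_mul trmxK.
have ww : w *m w^T = (sqnorm w)%:M.
  by rewrite [LHS]mx11_scalar -dotE.
have HH : H *m H^T = 1%:M.
  have WW : (w^T *m w) *m (w^T *m w) = sqnorm w *: (w^T *m w).
    by rewrite mulmxA -(mulmxA w^T) ww mul_mx_scalar -scalemxAl.
  rewrite HT /H; move: (w^T *m w) WW => W WW.
  set c := 2 / _; have E : c *: (c *: (sqnorm w *: W)) = c *: W + c *: W.
    by rewrite !scalerA -scalerDl; congr (_ *: _); rewrite /c; field.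
  rewrite mulmxBl mul1mx mulmxBr mulmx1 -scalemxAl -scalemxAr WW E.
  by rewrite opprB addrK subrK.
have yH : y *m H = x.
  rewrite /H mulmxBr mulmx1 -scalemxAr mulmxA [y *m _]mx11_scalar -dotE.
  rewrite mul_scalar_mx scalerA (_ : 2 / sqnorm w * dot y w = 1).
    by rewrite scale1r /w opprB addrC subrK.
  rewrite ww2.
  field.
  apply: contraNneq w0 => yw0.
  by rewrite ww2 yw0 mulr0.
have : \det H ^+ 2 == 1 by rewrite expr2 -{2}det_tr -det_mulmx HH det1.
rewrite sqrf_eq1 => /orP[/eqP dH|/eqP dH]; first by exists H.
exists (flip j *m H); split.
- by rewrite trmx_mul mulmxA -[X in X *m _]mulmxA HH mulmx1 flip_orthogonal.
- by rewrite det_mulmx det_flip dH mulrNN mulr1.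
- by rewrite mulmxA -scalemxAl delta_flip (negPf ij) scale1r.
Qed.

End Euclidean.

(** * The form of a rotationally symmetric metric *)

Section RadialForm.
Context {R : realType} {n : nat} (g : 'rV[R]_n -> 'M[R]_n).
Hypothesis grot : rotationally_symmetric g.
Hypothesis gsym : forall x, (g x)^T = g x.
Variables (i0 i1 i2 : 'I_n).
Hypotheses (i01 : i0 != i1) (i02 : i0 != i2) (i12 : i1 != i2).

Let e0 : 'rV[R]_n := delta_mx 0 i0.

Lemma metric_quarter_turn r i j k l : i != j -> i != i0 -> j != i0 ->
  g (r *: e0) k l = (if k == i then -1 else 1) * (if l == i then -1 else 1) *
    g (r *: e0) (tperm i j k) (tperm i j l).
Proof.
move=> ij ii0 ji0.
have := grot (quarter_turn_orthogonal i j) (det_quarter_turn ij) (r *: e0).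
rewrite -scalemxAl delta_quarter_turn eq_sym (negPf ii0) scale1r tpermD // => E.
by rewrite -(inner_delta (g _) k l) -{1}E inner_congr !delta_quarter_turn
  inner_scale inner_delta.
Qed.

(** Quarter turns fixing the axis force the metric there to be diagonal, with
    equal entries in the directions orthogonal to the axis. The third index
    [i2] provides, for each direction off the axis, another one to turn to. *)
Lemma metric_axis r : g (r *: e0) = (g (r *: e0) i1 i1)%:M +
  (g (r *: e0) i0 i0 - g (r *: e0) i1 i1) *: (e0^T *m e0).
Proof.
have symE k l : g (r *: e0) l k = g (r *: e0) k l by rewrite -{1}gsym mxE.
have off k l : k != i0 -> l != i0 -> k != l -> g (r *: e0) k l = 0.
  move=> k0 l0 kl; have := metric_quarter_turn r k l kl k0 l0.
  by rewrite tpermL tpermR eqxx eq_sym (negPf kl) mulr1 symE; lra.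
have off0 k : k != i0 -> g (r *: e0) i0 k = 0.
  move=> k0.
  have [l l0 kl] : exists2 l, l != i0 & k != l.
    have [->|ki1] := eqVneq k i1; first by exists i2; rewrite // eq_sym.
    by exists i1; rewrite // eq_sym.
  have := metric_quarter_turn r i0 k kl k0 l0.
  have := metric_quarter_turn r i0 l kl k0 l0.
  rewrite tpermL tpermR eqxx (eq_sym l) (negPf kl) (eq_sym i0 k) (negPf k0).
  by rewrite tpermD //; lra.
have dia k : k != i0 -> g (r *: e0) k k = g (r *: e0) i1 i1.
  have [->//|ki1 k0] := eqVneq k i1.
  have i10 : i1 != i0 by rewrite eq_sym.
  by rewrite (metric_quarter_turn r k k ki1 k0 i10) tpermL eqxx mulrNN !mul1r.
apply/matrixP => k l; rewrite !mxE big_ord1 !mxE !eqxx /=.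
have [->|k0] := eqVneq k i0; have [->|l0] := eqVneq l i0; rewrite /=.
- by rewrite mulr1n; ring.
- by rewrite (off0 l) // mulr0n; ring.
- by rewrite (negPf k0) (symE i0 k) (off0 k) // mulr0n; ring.
have [->|kl] := eqVneq k l; first by rewrite (dia l) // mulr1n /=; ring.
by rewrite (off k l) // mulr0n; ring.
Qed.

(** The coefficients of [metric_radial_form], read off on the axis [i0]. *)
Definition tangential (s : R) : R := g (Num.sqrt s *: e0) i1 i1.

Definition radial (s : R) : R :=
  (g (Num.sqrt s *: e0) i0 i0 - tangential s) / s.

(** Rotate [x] to the axis, where [metric_axis] applies. *)
Lemma metric_radial_form x : x != 0 ->
  g x = (tangential (sqnorm x))%:M + radial (sqnorm x) *: (x^T *m x).
Proof.
move=> x0; have [A [AA dA xE]] := rotation_from_axis x i01.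
have s0 : sqnorm x != 0 by rewrite sqnorm_eq0.
have AA' : A^T *m A = 1%:M by exact: mulmx1C.
set y : 'rV[R]_n := _ *: _ in xE.
have -> : g x = A^T *m g y *m A.
  rewrite -(grot AA dA y) xE !mulmxA AA' mul1mx -mulmxA AA' mulmx1 //.
have {xE} : x = Num.sqrt (sqnorm x) *: (e0 *m A) by rewrite -{1}xE /y -scalemxAl.
move: s0; rewrite {}/y; set s := sqnorm x => s0 xE.
have xx : x^T *m x = s *: (A^T *m (e0^T *m e0) *m A).
  rewrite xE -scalemxAr [_^T]linearZ /= -scalemxAl scalerA -expr2.
  by rewrite sqr_sqrtr ?sqnorm_ge0 // trmx_mul !mulmxA.
rewrite metric_axis -/(tangential s) mulmxDr mulmxDl mul_mx_scalar -scalemxAl.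
rewrite AA' scalemx1 -scalemxAr -scalemxAl xx scalerA /radial divfK //.
Qed.

End RadialForm.

(** * Calculus along lines *)

Section Calculus.
Context {R : realType}.

(** The difference [h - f] vanishes near [x], so its differential is zero. *)
Lemma near_eq_differentiable (V : normedModType R) (f h : V -> R) (x : V) :
  (\near x, f x = h x) -> differentiable f x -> differentiable h x.
Proof.
move=> fh df; pose k : V -> R := fun z => h z - f z.
have k0 : \forall z \near x, k z = 0.
  by apply: filterS fh => z; rewrite /k => ->; rewrite subrr.
have kx : k x = 0 := nbhs_singleton k0.
have ck : continuous (\0 : V -> R) by move=> z; exact: cvg_cst.
have ko : k \o shift x = cst (k x) + (\0 : V -> R) +o_ 0 id.
  apply: eqaddoE; apply/eqaddoP => e e0.
  have : \forall z \near (0 : V), k (z + x) = 0.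
    by move: k0; rewrite (near_shift 0 x) subr0.
  apply: filterS => z /= kz.
  rewrite !fctE /= kx kz !addr0 subr0 normr0 mulr_ge0 // ltW //.
have dk : differentiable k x.
  by apply/diff_locallyP; rewrite (diff_unique ck ko); split.
have -> : h = f + k by apply/funext => z; rewrite !fctE /k addrCA subrr addr0.
exact: differentiableD.
Qed.

(** On an open set the local extensions agree with the function near each
    point, so they have the same iterated partial derivatives. *)
Lemma smooth_on_open n (A : set 'rV[R]_n) (f : 'rV[R]_n -> R) :
  open A -> smooth_on A f ->
  forall s x, A x -> differentiable (pderivs s f) x.
Proof.
move=> oA sf s x Ax; have [U [h [oU Ux sh hf]]] := sf x Ax.
have E z : U z -> A z -> pderivs s h z = pderivs s f z.
  elim: s z => [|i s IH] z Uz Az; first exact: hf.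
  apply: near_eq_derive.
  have : nbhs z (U `&` A) by apply: filterI; apply: open_nbhs_nbhs.
  by apply: filterS => t [Ut At]; apply: IH.
apply: near_eq_differentiable (sh s x Ux).
have : nbhs x (U `&` A) by apply: filterI; apply: open_nbhs_nbhs.
by apply: filterS => t [Ut At]; apply: E.
Qed.

Lemma is_derive_line (V : normedModType R) (f : V -> R) (x v : V) (t d : R) :
  is_derive (t *: v + x) v f d ->
  is_derive t 1 (fun s => f (s *: v + x)) d.
Proof.
have E : (fun h : R => h^-1 *: (((fun s : R => f (s *: v + x)) \o shift t) (h *: 1)
      - f (t *: v + x))) =
    (fun h : R => h^-1 *: ((f \o shift (t *: v + x)) (h *: v) - f (t *: v + x))).
  by apply/funext => h /=; rewrite [h *: 1]mulr1 scalerDl addrA.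
by move=> [df dE]; split; rewrite /derivable /derive E.
Qed.

Lemma line_is_derive (V : normedModType R) (f : V -> R) (x v : V) (d : R) :
  is_derive (0 : R) 1 (fun s => f (s *: v + x)) d -> is_derive x v f d.
Proof.
have E : (fun h : R => h^-1 *: (((fun s : R => f (s *: v + x)) \o shift (0 : R)) (h *: 1)
      - f ((0 : R) *: v + x))) =
    (fun h : R => h^-1 *: ((f \o shift x) (h *: v) - f x)).
  by apply/funext => h /=; rewrite [h *: 1]mulr1 addr0 scale0r add0r.
by move=> [df dE]; split; rewrite /derivable /derive -E.
Qed.

Lemma is_derive_comp_real (V : normedModType R) (f : V -> R) (h : R -> R)
    (x v : V) (a b : R) :
  is_derive x v f a -> is_derive (f x) 1 h b -> is_derive x v (h \o f) (b * a).
Proof.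
move=> df dh; apply: line_is_derive.
apply: (@is_derive1_comp R h (fun s => f (s *: v + x))).
  by rewrite scale0r add0r.
by apply: is_derive_line; rewrite scale0r add0r.
Qed.

Lemma derive_pderiv n (f : 'rV[R]_n -> R) (x w : 'rV[R]_n) :
  differentiable f x -> 'D_w f x = \sum_i w 0 i * pderiv i f x.
Proof.
move=> df; rewrite deriveE // {1}(row_sum_delta w) linear_sum.
by apply: eq_bigr => i _; rewrite linearZ /= /pderiv deriveE.
Qed.

(** If [Q] were positive, then [q'] would be positive immediately to the right
    of [0], and [q] would exceed [q 0] there by the mean value theorem. *)
Lemma second_derivative_test (q q' : R -> R) (d Q : R) : 0 < d ->
  (forall t : R, `|t| < d -> is_derive t (1 : R) q (q' t)) ->
  is_derive (0 : R) 1 q' Q ->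
  (forall t : R, `|t| < d -> q t <= q 0) ->
  q' 0 = 0 /\ Q <= 0.
Proof.
move=> d0 dq dq' qmax.
have d0' : `|0 : R| < d by rewrite normr0.
have in_d t : t \in `]-d, d[ -> `|t| < d by rewrite in_itv /= ltr_norml.
have q'0 : q' 0 = 0.
  have [_ <-] := dq 0 d0'.
  suff [] : is_derive (0 : R) (1 : R) q 0 by [].
  apply: (@derive1_at_max R q (- d) d 0).
  - by rewrite ge0_cp // ltW.
  - by move=> t /in_d /dq [].
  - by rewrite in_itv /= oppr_lt0 d0.
  - by move=> t /in_d; exact: qmax.
split=> //; rewrite leNgt; apply/negP => Q0.
have [dq'1 dq'2] := dq'.
have : (fun h : R => h^-1 *: ((q' \o shift 0) (h *: 1) - q' 0)) @ 0^' --> Q.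
  by rewrite -dq'2; exact: dq'1.
move=> /cvgr_gt /(_ 0 Q0); rewrite near_withinE => -[e /= e0 He].
have q'pos t : 0 < t -> t < e -> 0 < q' t.
  move=> t0 te; have := He t.
  rewrite /ball_ /= sub0r normrN gtr0_norm // => /(_ te (lt0r_neq0 t0)).
  by rewrite addr0 [t *: 1]mulr1 q'0 subr0 pmulr_rgt0 // invr_gt0.
pose b := Num.min d e / 2.
have m0 : 0 < Num.min d e by rewrite lt_min d0.
have b0 : 0 < b by rewrite divr_gt0.
have bm : b < Num.min d e by rewrite /b; lra.
have bd : b < d by apply: (lt_le_trans bm); rewrite ge_min lexx.
have be : b < e by apply: (lt_le_trans bm); rewrite ge_min lexx orbT.
have [||c cb] := @MVT R q q' 0 b b0.
- move=> t; rewrite in_itv /= => /andP[t0 tb]; apply: dq.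
  by rewrite gtr0_norm // (lt_trans tb).
- apply: derivable_within_continuous => t; rewrite in_itv /= => /andP[t0 tb].
  by have [] := dq t; rewrite ?ger0_norm // (le_lt_trans tb).
rewrite subr0 => E.
move: cb; rewrite in_itv /= => /andP[c0 cb].
have : 0 < q b - q 0 by rewrite E mulr_gt0 // q'pos // (lt_trans cb).
by rewrite subr_gt0 ltNge qmax // gtr0_norm.
Qed.

End Calculus.

(** * Christoffel symbols and curvature of a radial metric *)

Lemma posdef_unitmx (R : realType) n (G : 'M[R]_n) :
  (forall u : 'rV[R]_n, u != 0 -> 0 < inner G u u) -> G \in unitmx.
Proof.
move=> Gpos; rewrite -row_free_unit; apply: inj_row_free => v vG.
apply/eqP; apply/contraT => /Gpos.
by rewrite /inner vG mul0mx mxE ltxx.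
Qed.

Lemma near_neq0 (R : realType) (V : normedModType R) (x : V) :
  x != 0 -> \forall y \near x, y != 0.
Proof.
move=> x0; have o : open (~` [set (0 : V)]).
  apply: closed_openC; apply: accessible_closed_set1.
  exact/hausdorff_accessible/norm_hausdorff.
have : nbhs x (~` [set (0 : V)]) by apply: open_nbhs_nbhs; split=> //; apply/eqP.
by apply: filterS => y /eqP.
Qed.

Lemma is_derive_coord (R : realType) n (x v : 'rV[R]_n) j :
  is_derive x v (fun y : 'rV[R]_n => y 0 j) (v 0 j).
Proof.
have dx : derivable (@id 'rV[R]_n) x v by exact: derivable_id.
split; first by have := (derivable_mxP (@id 'rV[R]_n) x v).1 dx; apply.
have := derive_mx dx; rewrite derive_id => /rowP /(_ j).
by rewrite [in RHS]mxE.
Qed.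

Lemma is_derive_sqnorm (R : realType) n (x v : 'rV[R]_n) :
  is_derive x v (fun y => sqnorm y) (2 * dot x v).
Proof.
have := @is_derive_sum _ _ _ n (fun i (y : 'rV[R]_n) => y 0 i * y 0 i) x v
  (fun i => x 0 i * v 0 i + x 0 i * v 0 i).
have -> : \sum_(i < n) (x 0 i * v 0 i + x 0 i * v 0 i) = 2 * dot x v.
  by rewrite big_split /= /dot; ring.
have -> : \sum_(i < n) (fun y : 'rV[R]_n => y 0 i * y 0 i) = (fun y => sqnorm y).
  by apply/funext => y; rewrite fct_sumE.
apply => i.
exact: (is_deriveM (is_derive_coord x v i) (is_derive_coord x v i)).
Qed.

(** The product rule at a zero of the first factor asks only for continuity of
    the second one. *)
Lemma is_derive_mul_id (R : realType) (m : R -> R) :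
  {for 0, continuous m} -> is_derive (0 : R) (1 : R) (fun t => t * m t) (m 0).
Proof.
move=> cm.
have H : (fun h : R => h^-1 *: (((fun t => t * m t) \o shift 0) (h *: 1) - 0 * m 0))
    @ 0^' --> m 0.
  have cm' : m @ 0^' --> m 0 by apply/continuous_withinNx.
  apply: cvg_trans cm'; apply: near_eq_cvg.
  rewrite near_withinE; apply: nearW => h h0 /=.
  by rewrite addr0 [h *: 1]mulr1 mul0r subr0 [_ *: _]mulrA mulVf // mul1r.
by split; [apply/cvg_ex; exists (m 0)|exact: (cvg_lim (@norm_hausdorff _ _) H)].
Qed.

Section RadialMetric.
Context {R : realType} {n : nat} (g : 'rV[R]_n -> 'M[R]_n).
Variables phi psi dphi dpsi : R -> R.
Hypothesis gE : forall x : 'rV[R]_n, x != 0 ->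
  g x = (phi (sqnorm x))%:M + psi (sqnorm x) *: (x^T *m x).
Hypothesis gpos : forall x, inner_product (g x).
Hypothesis phi_gt0 : forall s : R, 0 < s -> 0 < phi s.
Hypothesis sigma_gt0 : forall s : R, 0 < s -> 0 < phi s + s * psi s.
Hypothesis phi_derive : forall s : R, 0 < s -> is_derive s (1 : R) phi (dphi s).
Hypothesis psi_derive : forall s : R, 0 < s -> is_derive s (1 : R) psi (dpsi s).
Hypothesis dphi_continuous : forall s : R, 0 < s -> {for s, continuous dphi}.

Local Notation delta i j := ((i == j)%:R : R).

Lemma pderiv_metric i j l x : x != 0 ->
  pderiv i (fun y => g y j l) x =
    2 * dphi (sqnorm x) * x 0 i * delta j l +
    2 * dpsi (sqnorm x) * x 0 i * x 0 j * x 0 l +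
    psi (sqnorm x) * (delta i j * x 0 l + delta i l * x 0 j).
Proof.
move=> x0; have s0 : 0 < sqnorm x by rewrite sqnorm_gt0.
set v : 'rV[R]_n := delta_mx 0 i.
have dN := is_derive_sqnorm x v.
have d1 := is_derive_comp_real dN (phi_derive s0).
have d2 := is_derive_comp_real dN (psi_derive s0).
have cj := is_derive_coord x v j; have cl := is_derive_coord x v l.
have d := is_deriveD (is_deriveM d1 (is_derive_cst (delta j l) x v))
                     (is_deriveM d2 (is_deriveM cj cl)).
rewrite /pderiv (_ : 'D__ _ _ = 'D_v (((phi \o (fun y => sqnorm y)) * cst (delta j l)) +
    ((psi \o (fun y => sqnorm y)) * ((fun y : 'rV[R]_n => y 0 j) * (fun y => y 0 l)))) x);
  last first.
  apply: near_eq_derive; apply: filterS (near_neq0 x0) => y y0.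
  by rewrite gE // !mxE big_ord1 !mxE !fctE /= mulr_natr.
apply: (etrans (@derive_val _ _ _ _ _ _ _ d)); rewrite /v.
have -> : dot x v = x 0 i by rewrite dotC dot_deltal.
rewrite !mxE !eqxx /= !(eq_sym _ i) !fctE /GRing.scale /=; ring.
Qed.

(** This function and the two that follow are the coefficients in [christoffelE];
    [radial_factor] governs the second fundamental form of the spheres. *)
Definition radial_factor s : R := (psi s - dphi s) / (phi s + s * psi s).

Definition dlog_phi s : R := dphi s / phi s.

Definition mixed_factor s : R :=
  (dpsi s - 2 * dphi s * psi s / phi s) / (phi s + s * psi s).

(** Multiplying the right-hand side [G] by [g] gives back the derivatives of
    the metric; as [g] is invertible, an explicit inverse can be avoided. *)
Lemma christoffelE k i j x : x != 0 ->
  christoffel g k i j x =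
    dlog_phi (sqnorm x) * (x 0 i * delta j k + x 0 j * delta i k) +
    x 0 k * (delta i j * radial_factor (sqnorm x) +
             x 0 i * x 0 j * mixed_factor (sqnorm x)).
Proof.
move=> x0; have s0 : 0 < sqnorm x by rewrite sqnorm_gt0.
pose c := delta i j * radial_factor (sqnorm x) +
          x 0 i * x 0 j * mixed_factor (sqnorm x).
pose G : 'rV[R]_n := dlog_phi (sqnorm x) *:
  (x 0 i *: delta_mx 0 j + x 0 j *: delta_mx 0 i) + c *: x.
have dGx : dot G x = 2 * dlog_phi (sqnorm x) * x 0 i * x 0 j + c * sqnorm x.
  rewrite dotC !(dotDr, dotZr) ![dot x (delta_mx _ _)]dotC !dot_deltal; ring.
have Gg : G *m g x = phi (sqnorm x) *: G + (psi (sqnorm x) * dot G x) *: x.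
  rewrite gE // mulmxDr mul_mx_scalar -scalemxAr mulmxA [G *m _]mx11_scalar -dotE.
  by rewrite mul_scalar_mx scalerA.
have gT : (g x)^T = g x by have [] := gpos x.
have gU : g x \in unitmx by apply: posdef_unitmx; have [] := gpos x.
have L l : pderiv i (fun y => g y j l) x + pderiv j (fun y => g y i l) x
     - pderiv l (fun y => g y i j) x = 2 * (G *m g x) 0 l.
  rewrite !pderiv_metric // Gg dGx !mxE !eqxx /= (eq_sym j i) !(eq_sym l) /c.
  rewrite /dlog_phi /radial_factor /mixed_factor.
  have p0 := lt0r_neq0 (phi_gt0 s0); have q0 := lt0r_neq0 (sigma_gt0 s0).
  by field; rewrite p0 q0.
rewrite /christoffel; under eq_bigr do rewrite L mulrCA.
rewrite -mulr_sumr mulrA mulVf ?pnatr_eq0 // mul1r.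
have -> : \sum_l invmx (g x) k l * (G *m g x) 0 l = G 0 k.
  rewrite -[in RHS](mulmxK gU G) [RHS]mxE; apply: eq_bigr => l _.
  by rewrite mulrC; congr (_ * _); rewrite -{1}gT -trmx_inv mxE.
by rewrite /G /c !mxE !eqxx /= !(eq_sym k); ring.
Qed.

Variables (i0 i1 i2 : 'I_n).
Hypotheses (i01 : i0 != i1) (i02 : i0 != i2) (i12 : i1 != i2).

Lemma axis_line_neq0 (r t : R) i : r != 0 -> i0 != i ->
  t *: delta_mx 0 i + r *: delta_mx 0 i0 != 0 :> 'rV[R]_n.
Proof.
move=> r0 ii0; apply: contraNneq r0 => /rowP /(_ i0).
by rewrite !mxE !eqxx (negPf ii0) /= mulr0 add0r mulr1 => ->.
Qed.

Lemma sqnorm_axis_line (r t : R) i : i0 != i ->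
  sqnorm (t *: delta_mx 0 i + r *: delta_mx 0 i0 : 'rV[R]_n) = t ^+ 2 + r ^+ 2.
Proof.
move=> ii0; rewrite !(dotDr, dotZr) ![dot (_ + _) _]dotC !(dotDr, dotZr).
rewrite !dot_delta !eqxx (negPf ii0) eq_sym (negPf ii0) /=; ring.
Qed.

Lemma continuous_along_axis (m : R -> R) (r : R) : {for r ^+ 2, continuous m} ->
  {for 0, continuous (fun t : R => m (t ^+ 2 + r ^+ 2))}.
Proof.
move=> cm; apply: (@continuous_comp _ _ _ (fun t : R => t ^+ 2 + r ^+ 2) m).
  by apply: cvgD; [exact: exprn_continuous|exact: cvg_cst].
by rewrite expr0n add0r.
Qed.

(** On the lines leaving the axis in the directions [i1] and [i2], the symbols
    to differentiate are [t] times a function of [t ^+ 2 + r ^+ 2], so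
    [is_derive_mul_id] spares the second derivatives of the metric. *)
Lemma riemann_axis r : 0 < r ->
  riemann g i1 i1 i2 i2 (r *: delta_mx 0 i0) =
    radial_factor (r ^+ 2) - dlog_phi (r ^+ 2) +
    r ^+ 2 * radial_factor (r ^+ 2) * dlog_phi (r ^+ 2).
Proof.
move=> r0; have s0 : 0 < r ^+ 2 by rewrite exprn_gt0.
have rN0 := lt0r_neq0 r0.
have i21 : i2 != i1 by rewrite eq_sym.
have i10 : i1 != i0 by rewrite eq_sym.
have i20 : i2 != i0 by rewrite eq_sym.
set x : 'rV[R]_n := r *: _.
have x0 : x != 0.
  by have := axis_line_neq0 0 rN0 i01; rewrite scale0r add0r.
have sx : sqnorm x = r ^+ 2 by rewrite sqnorm_axis.
have cphi : {for r ^+ 2, continuous phi}.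
  apply: differentiable_continuous; apply/derivable1_diffP.
  by have [] := phi_derive s0.
have cpsi : {for r ^+ 2, continuous psi}.
  apply: differentiable_continuous; apply/derivable1_diffP.
  by have [] := psi_derive s0.
have cdphi := dphi_continuous s0.
have p0 := lt0r_neq0 (phi_gt0 s0); have q0 := lt0r_neq0 (sigma_gt0 s0).
have crf : {for r ^+ 2, continuous radial_factor}.
  apply: cvgM; first exact: cvgB.
  by apply: cvgV => //; apply: cvgD => //; apply: cvgM.
have cdl : {for r ^+ 2, continuous dlog_phi} by apply: cvgM => //; exact: cvgV.
have D1 : pderiv i1 (christoffel g i1 i2 i2) x = radial_factor (r ^+ 2).
  apply: (@derive_val _ _ _ _ _ _ _ (line_is_derive _)).
  have := is_derive_mul_id (continuous_along_axis crf).
  rewrite expr0n add0r; congr (is_derive _ _ _ _); apply/funext => t.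
  rewrite christoffelE ?axis_line_neq0 // sqnorm_axis_line //.
  rewrite !mxE !eqxx /= (negPf i21) (negPf i10) (negPf i20) /=; ring.
have D2 : pderiv i2 (christoffel g i1 i1 i2) x = dlog_phi (r ^+ 2).
  apply: (@derive_val _ _ _ _ _ _ _ (line_is_derive _)).
  have := is_derive_mul_id (continuous_along_axis cdl).
  rewrite expr0n add0r; congr (is_derive _ _ _ _); apply/funext => t.
  rewrite christoffelE ?axis_line_neq0 // sqnorm_axis_line //.
  rewrite !mxE !eqxx /= (negPf i12) (negPf i21) (negPf i10) (negPf i20) /=; ring.
rewrite /riemann D1 D2; congr (_ + _).
have x1 : x 0 i1 = 0 by rewrite !mxE (negPf i10) mulr0.
have x2 : x 0 i2 = 0 by rewrite !mxE (negPf i20) mulr0.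
have x0r : x 0 i0 = r by rewrite !mxE !eqxx mulr1.
rewrite (bigD1 i0) //= big1 => [|m m0].
  rewrite !christoffelE // sx x1 x2 x0r !eqxx.
  rewrite (negPf i01) (negPf i21) (negPf i12) /=; ring.
have xm : x 0 m = 0 by rewrite !mxE (negPf m0) mulr0.
rewrite !christoffelE // sx x1 x2 xm !eqxx (negPf i12) /=; ring.
Qed.

Lemma sectional_curvature_axis r : 0 < r ->
  sectional_curvature g (r *: delta_mx 0 i0) (delta_mx 0 i1) (delta_mx 0 i2) =
  riemann g i1 i1 i2 i2 (r *: delta_mx 0 i0) / phi (r ^+ 2).
Proof.
move=> r0; have s0 : 0 < r ^+ 2 by rewrite exprn_gt0.
have p0 := lt0r_neq0 (phi_gt0 s0).
set x : 'rV[R]_n := r *: _.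
have x0 : x != 0 by have := axis_line_neq0 0 (lt0r_neq0 r0) i01; rewrite scale0r add0r.
have sx : sqnorm x = r ^+ 2 by rewrite sqnorm_axis.
have dx i : i0 != i -> dot x (delta_mx 0 i) = 0.
  by move=> h; rewrite dotZl dot_delta (negPf h) mulr0.
rewrite /sectional_curvature; set Q := \row_l _.
have only (F : 'I_n -> R) i : (forall k, k != i -> F k = 0) -> \sum_k F k = F i.
  by move=> F0; rewrite (bigD1 i) //= big1 ?addr0.
have QE : dot Q (delta_mx 0 i1) = riemann g i1 i1 i2 i2 x.
  rewrite /dot (only _ i1) => [|k /negPf ki]; last by rewrite !mxE ki mulr0.
  rewrite mxE (only _ i1) => [|k /negPf ki]; last first.
    by apply: big1 => j _; apply: big1 => l _; rewrite !mxE ki mulr0 !mul0r.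
  rewrite (only _ i2) => [|k /negPf ki]; last first.
    by apply: big1 => j _; rewrite !mxE ki mulr0 mul0r.
  rewrite (only _ i2) => [|k /negPf ki]; last by rewrite !mxE ki mulr0.
  by rewrite !mxE !eqxx /= !mulr1.
rewrite gE // !inner_scalar_rank1 QE sx !dot_delta !eqxx (negPf i12) !dx // !(dotC _ x) !dx // /=.
by field.
Qed.

(** In terms of the area radius [f], where [f ^+ 2 = s * phi s], this is the
    inequality [f_s ^+ 2 >= 1] for the derivative of [f] in the distance. *)
Lemma curvature_le0_axis r : 0 < r ->
  sectional_curvature g (r *: delta_mx 0 i0) (delta_mx 0 i1) (delta_mx 0 i2) <= 0 ->
  let s := r ^+ 2 in
  phi s * (phi s + s * psi s) <= (phi s + s * dphi s) ^+ 2.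
Proof.
move=> r0; have s0 : 0 < r ^+ 2 by rewrite exprn_gt0.
rewrite sectional_curvature_axis // riemann_axis //=.
move: (r ^+ 2) s0 => s s0; set K := _ / _ => K0.
have p0 := phi_gt0 s0; have q0 := sigma_gt0 s0.
rewrite -subr_ge0.
have -> : (phi s + s * dphi s) ^+ 2 - phi s * (phi s + s * psi s) =
    - K * (s * phi s ^+ 2 * (phi s + s * psi s)).
  by rewrite /K /radial_factor /dlog_phi; field; rewrite !lt0r_neq0.
apply: mulr_ge0; first by rewrite oppr_ge0.
by rewrite !mulr_ge0 // ltW // exprn_gt0.
Qed.

End RadialMetric.

(** * Mean convexity of the spheres *)

Lemma orbit_tangent_axis (R : realType) n (r : R) (i j : 'I_n) :
  r != 0 -> i != j ->
  orbit_tangent (r *: delta_mx 0 i : 'rV[R]_n) (delta_mx 0 j).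
Proof.
move=> r0 ij; exists (r^-1 *: (delta_mx i j - delta_mx j i)).
  by rewrite !linearZ /= linearB /= !trmx_delta opprB.
rewrite -scalemxAr -scalemxAl scalerA mulVf // scale1r mulmxBr.
by rewrite mul_delta_mx mul_delta_mx_0 // subr0.
Qed.

Lemma row_free_delta (R : realType) n (i j : 'I_n) : i != j ->
  row_free (col_mx (delta_mx 0 i) (delta_mx 0 j) : 'M[R]_(1 + 1, n)).
Proof.
move=> ij; apply: inj_row_free => v; rewrite -[v]hsubmxK mul_row_col.
rewrite [lsubmx v]mx11_scalar [rsubmx v]mx11_scalar !mul_scalar_mx => /rowP h.
have := h i; have := h j; rewrite !mxE !eqxx (negPf ij) eq_sym (negPf ij) /=.
rewrite !mulr1 !mulr0 addr0 add0r => -> ->.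
by rewrite raddf0 row_mx0.
Qed.

Section MeanConvexity.
Context {R : realType} {n : nat} (g : 'rV[R]_n -> 'M[R]_n).
Hypothesis gsmooth : smooth_mx_on setT g.
Hypothesis gpos : forall x, inner_product (g x).
Hypothesis grot : rotationally_symmetric g.
Variables (i0 i1 i2 : 'I_n).
Hypotheses (i01 : i0 != i1) (i02 : i0 != i2) (i12 : i1 != i2).
Hypothesis curv_le0 : forall r, 0 < r ->
  sectional_curvature g (r *: delta_mx 0 i0) (delta_mx 0 i1) (delta_mx 0 i2) <= 0.

Let e0 : 'rV[R]_n := delta_mx 0 i0.
Let phi := tangential g i0 i1.
Let psi := radial g i0 i1.
Let axis_entry (i j : 'I_n) (r : R) : R := g (r *: e0) i j.
Let axis_slope (i j : 'I_n) (r : R) : R := pderiv i0 (fun y => g y i j) (r *: e0).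
Let dphi (s : R) : R := axis_slope i1 i1 (Num.sqrt s) * (2 * Num.sqrt s)^-1.
Let dpsi (s : R) : R := 'D_1 psi s.

Lemma differentiable_entry i j s x :
  differentiable (pderivs s (fun y => g y i j)) x.
Proof. exact: (smooth_on_open openT (gsmooth i j)). Qed.

Lemma is_derive_axis_entry i j (r : R) :
  is_derive r (1 : R) (axis_entry i j) (axis_slope i j r).
Proof.
have := @is_derive_line R _ (fun y => g y i j) 0 e0 r (axis_slope i j r).
rewrite addr0 (_ : (fun s => g (s *: e0 + 0) i j) = axis_entry i j); last first.
  by apply/funext => s; rewrite addr0.
by apply; apply: derivableP; apply: diff_derivable; exact: (differentiable_entry i j [::]).
Qed.

Lemma axis_slope_continuous i j : continuous (axis_slope i j).
Proof.
move=> r; apply: (@continuous_comp _ _ _ (fun r : R => r *: e0)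
  (pderiv i0 (fun y => g y i j))); first exact: scalel_continuous.
exact/differentiable_continuous/(differentiable_entry i j [:: i0]).
Qed.

Lemma phi_is_derive (s : R) : 0 < s -> is_derive s (1 : R) phi (dphi s).
Proof.
move=> s0; apply: (@is_derive1_comp R (axis_entry i1 i1) Num.sqrt).
  exact: is_derive_axis_entry.
exact: is_derive1_sqrt.
Qed.

Lemma psi_is_derive (s : R) : 0 < s -> is_derive s (1 : R) psi (dpsi s).
Proof.
move=> s0; apply: derivableP.
have d0 : derivable (fun t => axis_entry i0 i0 (Num.sqrt t)) s 1.
  have [] // := @is_derive1_comp R (axis_entry i0 i0) Num.sqrt s _ _
    (is_derive_axis_entry i0 i0 _) (is_derive1_sqrt s0).
have d1 : derivable phi s 1 by have [] := phi_is_derive s0.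
have -> : psi = ((fun t => axis_entry i0 i0 (Num.sqrt t)) - phi) *
                (fun t : R => t^-1) by [].
apply: derivableM; first exact: derivableB.
by apply: derivableV; [exact: lt0r_neq0|exact: derivable_id].
Qed.

Lemma dphi_is_continuous (s : R) : 0 < s -> {for s, continuous dphi}.
Proof.
move=> s0; apply: cvgM.
  apply: (@continuous_comp _ _ _ (@Num.sqrt R) (axis_slope i1 i1)).
    exact: sqrt_continuous.
  exact: axis_slope_continuous.
apply: cvgV; first by rewrite mulf_neq0 ?lt0r_neq0 ?sqrtr_gt0.
by apply: cvgM; [exact: cvg_cst|exact: sqrt_continuous].
Qed.

Lemma entry_gt0 x i : 0 < g x i i.
Proof.
rewrite -inner_delta; have [_] := gpos x; apply.
by rewrite -sqnorm_eq0 dot_delta eqxx oner_eq0.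
Qed.

Lemma phi_pos (s : R) : 0 < s -> 0 < phi s.
Proof. by move=> _; exact: entry_gt0. Qed.

Lemma sigma_pos (s : R) : 0 < s -> 0 < phi s + s * psi s.
Proof.
move=> s0; rewrite /psi /radial mulrC divfK ?lt0r_neq0 // addrC subrK.
exact: entry_gt0.
Qed.

Lemma g_radial x : x != 0 ->
  g x = (phi (sqnorm x))%:M + psi (sqnorm x) *: (x^T *m x).
Proof.
apply: (metric_radial_form grot _ i01 i02 i12) => y.
by have [] := gpos y.
Qed.

(** The derivative of [s * phi s], the squared area radius, is [phi 0] at the
    origin, and nonpositive curvature keeps it from vanishing. *)
Lemma area_radius_increasing (s : R) : 0 < s -> 0 < phi s + s * dphi s.
Proof.
(* [P r] is the derivative at [s = r ^+ 2], in a form continuous at [r = 0]. *)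
pose P (r : R) : R := axis_entry i1 i1 r + r / 2 * axis_slope i1 i1 r.
have PE (r : R) : 0 < r -> phi (r ^+ 2) + r ^+ 2 * dphi (r ^+ 2) = P r.
  move=> r0; rewrite /phi /tangential /dphi /P sqrtr_sqr gtr0_norm // -/e0.
  by rewrite -/(axis_entry i1 i1 r); field; exact: lt0r_neq0.
have Pc : continuous P.
  move=> r; apply: cvgD.
    apply/differentiable_continuous/derivable1_diffP.
    by have [] := is_derive_axis_entry i1 i1 r.
  apply: cvgM; last exact: axis_slope_continuous.
  by apply: cvgM; [exact: cvg_id|exact: cvg_cst].
have P0 : 0 < P 0 by rewrite /P !mul0r addr0; exact: entry_gt0.
move=> s0; set r := Num.sqrt s.
have r0 : 0 < r by rewrite sqrtr_gt0.
have -> : s = r ^+ 2 by rewrite sqr_sqrtr // ltW.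
rewrite PE // ltNge; apply/negP => Pr.
have [||c] := @IVT R P 0 r 0 (ltW r0).
- exact: continuous_subspaceT.
- by rewrite ge_min Pr orbT le_max (ltW P0).
rewrite in_itv /= => /andP[c0 _] Pc0.
have {}c0 : 0 < c.
  by rewrite lt_def c0 andbT; apply/eqP => cE; move: P0; rewrite -{2}cE Pc0 ltxx.
have := curvature_le0_axis g_radial gpos phi_pos sigma_pos phi_is_derive
  psi_is_derive dphi_is_continuous i01 i02 i12 c0 (curv_le0 c0).
rewrite /= PE // Pc0 expr0n /= leNgt => /negP; apply.
by apply: mulr_gt0; [apply: phi_pos|apply: sigma_pos]; rewrite exprn_gt0.
Qed.

(** Strict mean convexity of the sphere through [x]: on its tangent space the
    Hessian of [sqnorm] for [g] is [2 * (1 - k)] times the Euclidean product,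
    so [k < 1] says that it is positive. The numbers [p] and [q] describe [g]
    in the tangential and in the radial direction. *)
Lemma spheres_mean_convex x : x != 0 -> exists p q k : R,
  [/\ 0 < p, 0 < q, k < 1 &
    [/\ forall u v, dot u x = 0 -> dot v x = 0 -> inner (g x) u v = p * dot u v,
        forall w, inner (g x) w x = q * dot w x &
        forall u v, dot u x = 0 -> dot v x = 0 ->
          dot (\row_k \sum_i \sum_j christoffel g k i j x * u 0 i * v 0 j) x =
          k * dot u v]].
Proof.
move=> x0; have s0 : 0 < sqnorm x by rewrite sqnorm_gt0.
set s := sqnorm x in s0.
exists (phi s), (phi s + s * psi s), (s * radial_factor phi psi dphi s).
have q0 := sigma_pos s0.
split; [exact: phi_pos|exact: q0| |].
  rewrite -subr_gt0 (_ : _ - _ = (phi s + s * dphi s) / (phi s + s * psi s)).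
    by rewrite divr_gt0 // area_radius_increasing.
  by rewrite /radial_factor; field; exact: lt0r_neq0.
split=> [u v ux vx|w|u v ux vx].
- by rewrite g_radial // inner_scalar_rank1 ux mulr0 mul0r addr0.
- by rewrite g_radial // inner_scalar_rank1 -/s; ring.
have E k : \sum_i \sum_j christoffel g k i j x * u 0 i * v 0 j =
    dlog_phi phi dphi s * (dot u x * v 0 k + dot v x * u 0 k) +
    x 0 k * (radial_factor phi psi dphi s * dot u v +
             mixed_factor phi psi dphi dpsi s * (dot u x * dot v x)).
  have delta_sum (F : 'I_n -> R) i : \sum_j (i == j)%:R * F j = F i.
    rewrite (bigD1 i) //= big1 ?addr0 ?eqxx ?mul1r // => j.
    by rewrite eq_sym => /negPf ->; rewrite mul0r.
  transitivity (\sum_i (dlog_phi phi dphi s * (u 0 i * x 0 i * v 0 k +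
      (k == i)%:R * (u 0 i * dot v x)) +
    x 0 k * (radial_factor phi psi dphi s * (u 0 i * v 0 i) +
             mixed_factor phi psi dphi dpsi s * (u 0 i * x 0 i * dot v x)))).
    apply: eq_bigr => i _.
    transitivity (\sum_j (dlog_phi phi dphi s * (u 0 i * x 0 i) * ((k == j)%:R * v 0 j) +
      dlog_phi phi dphi s * (k == i)%:R * u 0 i * (v 0 j * x 0 j) +
      x 0 k * radial_factor phi psi dphi s * u 0 i * ((i == j)%:R * v 0 j) +
      x 0 k * mixed_factor phi psi dphi dpsi s * u 0 i * x 0 i * (v 0 j * x 0 j))).
      apply: eq_bigr => j _.
      rewrite (christoffelE g_radial gpos phi_pos sigma_pos phi_is_derive psi_is_derive) //.
      by rewrite (eq_sym j k) (eq_sym i k) -/s; ring.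
    by rewrite !big_split /= -!mulr_sumr !delta_sum /dot; ring.
  rewrite big_split /= -!mulr_sumr !big_split /= -!mulr_sumr delta_sum.
  by rewrite -!mulr_suml -/(dot u x) -/(dot u v); ring.
rewrite ux vx in E.
rewrite /dot; under eq_bigr do rewrite mxE E.
transitivity (\sum_i radial_factor phi psi dphi s * dot u v * (x 0 i * x 0 i)).
  by apply: eq_bigr => i _; ring.
by rewrite -mulr_sumr -/(dot u v) -/(sqnorm x) -/s; ring.
Qed.

End MeanConvexity.

Lemma is_derive_bigsum (R : realType) (V : normedModType R) m
    (f : 'I_m -> V -> R) (df : 'I_m -> R) (x v : V) :
  (forall i, is_derive x v (f i) (df i)) ->
  is_derive x v (fun y => \sum_i f i y) (\sum_i df i).
Proof.
move=> h; rewrite (_ : (fun y => _) = \sum_i f i); last first.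
  by apply/funext => y; rewrite fct_sumE.
exact: is_derive_sum.
Qed.

(** * Hypersurfaces at a farthest point *)

Section Touching.
Context {R : realType} {m n : nat} (F : 'rV[R]_m -> 'rV[R]_n).
Variables (U : set 'rV[R]_m) (y : 'rV[R]_m).
Hypotheses (openU : open U) (Uy : U y) (smoothF : smooth_mx_on U F).
Hypothesis y_max : forall z, U z -> sqnorm (F z) <= sqnorm (F y).

Let comp k (z : 'rV[R]_m) : R := F z 0 k.
Let x := F y.
Let J := 'J F y.
Let hess (a b : 'I_m) : R :=
  dot (\row_k pderiv a (pderiv b (comp k)) y) x.

Lemma differentiable_comp_pderivs k s z : U z -> differentiable (pderivs s (comp k)) z.
Proof. exact: (smooth_on_open openU (smoothF 0 k)). Qed.

Lemma jacobian_entry a k : J a k = pderiv a (comp k) y.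
Proof.
have dF : differentiable F y.
  have -> : F = \sum_k (fun z => comp k z *: delta_mx 0 k).
    by apply/funext => z; rewrite fct_sumE; exact: row_sum_delta.
  apply: differentiable_sum => k'; apply: differentiableZl.
  exact: (differentiable_comp_pderivs k' [::] Uy).
rewrite /pderiv.
have dD : derivable F y (delta_mx 0 a) by exact: diff_derivable.
have := derive_mx dD; rewrite deriveEjacobian // -rowE.
by move=> /rowP /(_ k); rewrite !mxE.
Qed.

(** The derivative tests for [sqnorm \o F] along the line in direction [w]. *)
Lemma max_sqnorm (w : 'rV[R]_m) :
  dot (w *m J) x = 0 /\
  sqnorm (w *m J) + \sum_a \sum_b w 0 a * w 0 b * hess a b <= 0.
Proof.
pose line (t : R) := t *: w + y.
have line0 : line 0 = y by rewrite /line scale0r add0r.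
have [d /= d0 dU] : nbhs (0 : R) (line @^-1` U).
  have cl : {for 0, continuous line}.
    by apply: cvgD; [exact: scalel_continuous|exact: cvg_cst].
  by apply: cl; rewrite line0; apply: open_nbhs_nbhs.
have {}dU t : `|t| < d -> U (line t).
  by move=> td; apply: dU; rewrite /= /ball_ sub0r normrN.
pose p k z := \sum_b w 0 b * pderiv b (comp k) z.
have dcomp k t : `|t| < d ->
    is_derive t (1 : R) (fun s => comp k (line s)) (p k (line t)).
  move=> td; apply: is_derive_line.
  have df := differentiable_comp_pderivs k [::] (dU t td).
  by rewrite /p -(derive_pderiv w df); exact/derivableP/diff_derivable.
pose P k := \sum_b w 0 b * \sum_a w 0 a * pderiv a (pderiv b (comp k)) y.
have dp k : is_derive (0 : R) (1 : R) (fun s => p k (line s)) (P k).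
  apply: is_derive_bigsum => b.
  apply: (@is_deriveZ R R R (fun s => pderiv b (comp k) (line s))).
  have df := differentiable_comp_pderivs k [:: b] Uy.
  rewrite -(derive_pderiv w df); apply: is_derive_line.
  by rewrite scale0r add0r; exact/derivableP/diff_derivable.
have pJ k : p k y = (w *m J) 0 k.
  by rewrite mxE; apply: eq_bigr => b _; rewrite jacobian_entry.
pose q' t := \sum_k (comp k (line t) * p k (line t) + comp k (line t) * p k (line t)).
have dq t : `|t| < d -> is_derive t (1 : R) (fun s => sqnorm (F (line s))) (q' t).
  move=> td; apply: is_derive_bigsum => k.
  exact: (is_deriveM (dcomp k t td) (dcomp k t td)).
have d00 : `|0 : R| < d by rewrite normr0.
have dq' : is_derive (0 : R) (1 : R) q'
    (\sum_k ((comp k y * P k + p k y * p k y) + (comp k y * P k + p k y * p k y))).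
  apply: is_derive_bigsum => k.
  have h := is_deriveM (dcomp k 0 d00) (dp k); rewrite line0 in h.
  exact: (is_deriveD h h).
have qmax t : `|t| < d -> sqnorm (F (line t)) <= sqnorm (F (line 0)).
  by move=> td; rewrite line0; apply/y_max/dU.
have [q'0 Q0] := second_derivative_test d0 dq dq' qmax.
split.
  move: q'0; rewrite /q' line0 big_split /= => q'0.
  have -> : dot (w *m J) x = \sum_k comp k y * p k y.
    by apply: eq_bigr => k _; rewrite pJ mulrC.
  by lra.
move: Q0; rewrite big_split /= => Q0.
have -> : sqnorm (w *m J) + \sum_a \sum_b w 0 a * w 0 b * hess a b =
    \sum_k (comp k y * P k + p k y * p k y); last by lra.
rewrite big_split /= addrC; congr (_ + _).
  by apply: eq_bigr => k _; rewrite pJ.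
rewrite exchange_big /=.
transitivity (\sum_b \sum_a \sum_k
    w 0 a * w 0 b * (pderiv a (pderiv b (comp k)) y * comp k y)).
  apply: eq_bigr => b _; apply: eq_bigr => a _; rewrite mulr_sumr.
  by apply: eq_bigr => k _; rewrite mxE.
under [LHS]eq_bigr => b _ do rewrite exchange_big.
rewrite exchange_big /=; apply: eq_bigr => k _.
rewrite /P mulr_sumr; apply: eq_bigr => b _.
rewrite !mulr_sumr; apply: eq_bigr => a _; ring.
Qed.

Hypothesis rankJ : \rank J = m.

Let K := J *m J^T.

Lemma jacobian_rows_free (w : 'rV[R]_m) : w *m J = 0 -> w = 0.
Proof.
move=> wJ; have fJ : row_free J by rewrite /row_free rankJ.
by apply: (row_free_inj fJ); rewrite wJ mul0mx.
Qed.

Lemma gram_unit : K \in unitmx.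
Proof.
rewrite -row_free_unit; apply: inj_row_free => w wK; apply: jacobian_rows_free.
by apply/eqP; rewrite -sqnorm_eq0 dotE trmx_mul mulmxA -(mulmxA w) wK mul0mx mxE.
Qed.

Lemma gramE a b : K a b = dot (row a J) (row b J).
Proof. by rewrite mxE; apply: eq_bigr => k _; rewrite !mxE. Qed.

Lemma gram_sym : K^T = K.
Proof. by rewrite trmx_mul trmxK. Qed.

Lemma sum_gram_inv : \sum_a \sum_b invmx K a b * K a b = m%:R.
Proof.
rewrite -(mxtrace1 R m) -(mulVmx gram_unit).
apply: eq_bigr => a _; rewrite mxE; apply: eq_bigr => b _.
by rewrite -{2}gram_sym mxE.
Qed.

(** The inverse Gram matrix is [N *m N^T] for [N := invmx K *m J], so tracing
    the Hessian against it amounts to summing the second derivative test over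
    the columns of [N]. *)
Lemma trace_hess : m%:R + \sum_a \sum_b invmx K a b * hess a b <= 0.
Proof.
pose N := invmx K *m J.
have NN : N *m N^T = invmx K.
  by rewrite trmx_mul trmx_inv gram_sym mulmxA -(mulmxA _ J) mulVmx ?gram_unit // mul1mx.
have T : \sum_k sqnorm (row k N^T *m J) = m%:R.
  transitivity (\tr (N^T *m J *m (N^T *m J)^T)).
    by apply: eq_bigr => k _; rewrite dotE -!row_mul !mxE; apply: eq_bigr => l _; rewrite !mxE.
  rewrite [(N^T *m J)^T]trmx_mul trmxK mulmxA -(mulmxA N^T) -/K -mulmxA mxtrace_mulC -mulmxA NN.
  by rewrite mulmxV ?gram_unit // mxtrace1.
have -> : m%:R + \sum_a \sum_b invmx K a b * hess a b =
    \sum_k (sqnorm (row k N^T *m J) +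
      \sum_a \sum_b (row k N^T) 0 a * (row k N^T) 0 b * hess a b).
  rewrite big_split /= T; congr (_ + _).
  rewrite [RHS]exchange_big /=; apply: eq_bigr => a _.
  rewrite [RHS]exchange_big /=; apply: eq_bigr => b _.
  rewrite -mulr_suml -NN mxE; congr (_ * _).
  by apply: eq_bigr => k _; rewrite !mxE.
by apply: sumr_le0 => k _; have [] := max_sqnorm (row k N^T).
Qed.

Hypothesis m_gt0 : (0 < m)%N.

(** At the origin the Hessian term of [trace_hess] would vanish. *)
Lemma max_point_neq0 : x != 0.
Proof.
apply/eqP => x0; have := trace_hess.
rewrite big1 => [|a _]; last first.
  by apply: big1 => b _; rewrite /hess x0 /dot big1 ?mulr0 // => k _; rewrite [X in _ * X]mxE mulr0.
by rewrite addr0 leNgt ltr0n m_gt0.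
Qed.

(** At a farthest point the hypersurface lies inside the sphere it touches,
    so it is at least as curved as that strictly mean convex sphere. *)
Lemma no_minimal_touching (g : 'rV[R]_n -> 'M[R]_n) (p q k : R) :
  0 < p -> 0 < q -> k < 1 ->
  (forall u v, dot u x = 0 -> dot v x = 0 -> inner (g x) u v = p * dot u v) ->
  (forall w, inner (g x) w x = q * dot w x) ->
  (forall u v, dot u x = 0 -> dot v x = 0 ->
    dot (\row_k \sum_i \sum_j christoffel g k i j x * u 0 i * v 0 j) x =
    k * dot u v) ->
  (forall nu, unit_normal g F y nu -> mean_curvature g F y nu = 0) -> False.
Proof.
move=> p0 q0 k1 gtan gx Gx minimal.
have s0 : 0 < sqnorm x by rewrite sqnorm_gt0 max_point_neq0.
have tan a : dot (row a J) x = 0 by rewrite rowE; have [] := max_sqnorm (delta_mx 0 a).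
(* [c *: x] is the outer unit normal of the sphere, hence of [F]. *)
pose c := (Num.sqrt (q * sqnorm x))^-1.
have c0 : 0 < c by rewrite invr_gt0 sqrtr_gt0 mulr_gt0.
have innerc w : inner (g x) w (c *: x) = c * q * dot w x.
  by rewrite -[w]scale1r inner_scale gx scale1r mul1r mulrA.
have nuP : unit_normal g F y (c *: x).
  split=> [|a]; last by rewrite -/x innerc -/J tan mulr0.
  rewrite -/x innerc dotZl mulrACA -expr2 /c exprVn sqr_sqrtr.
    by rewrite mulrC mulfV // mulf_neq0 // lt0r_neq0.
  by rewrite mulr_ge0 // ltW.
have := minimal _ nuP; rewrite /mean_curvature -/x -/J.
have -> : J *m g x *m J^T = p *: K.
  apply/matrixP => a b; rewrite [RHS]mxE gramE -gtan //.
  by rewrite -(inner_delta (J *m g x *m J^T)) inner_congr -!rowE.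
rewrite invmxZ ?unitmxZ ?unitfE ?lt0r_neq0 ?gram_unit //.
rewrite (eq_bigr (fun a => \sum_b p^-1 * c * q *
    (invmx K a b * hess a b + k * (invmx K a b * K a b)))) => [|a _]; last first.
  apply: eq_bigr => b _; rewrite mxE innerc.
  have -> : dot (\row_l (pderiv a (pderiv b (fun z => F z 0 l)) y +
      \sum_i \sum_j christoffel g l i j x * J a i * J b j)) x =
      hess a b + k * K a b; last by ring.
  rewrite gramE -Gx // /hess /dot -big_split /=; apply: eq_bigr => l _.
  rewrite !mxE -mulrDl; congr ((_ + _) * _).
  by apply: eq_bigr => i _; apply: eq_bigr => j _; rewrite !mxE.
have -> : \sum_a \sum_b p^-1 * c * q *
      (invmx K a b * hess a b + k * (invmx K a b * K a b)) =
    p^-1 * c * q * (\sum_a \sum_b invmx K a b * hess a b + k * m%:R).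
  rewrite -sum_gram_inv mulr_sumr -big_split mulr_sumr; apply: eq_bigr => a _ /=.
  by rewrite -mulr_sumr big_split -mulr_sumr.
have th := trace_hess => /eqP.
rewrite !mulf_eq0 invr_eq0 (gt_eqF p0) (gt_eqF c0) (gt_eqF q0) /= => /eqP hE.
have : 0 < (1 - k) * m%:R by rewrite mulr_gt0 ?subr_gt0 ?ltr0n.
by lra.
Qed.

End Touching.

(** * Closed hypersurfaces *)

Section ClosedHypersurface.
Context {R : realType} {m : nat} {S : topologicalType} (A : set (chart R m S)).
Hypothesis mfd : manifold_with_boundary A.
Hypothesis no_bdry : bdry A = set0.

(** Without boundary points the first coordinate of a chart is positive, not
    just nonnegative, so the image is open in the whole space. *)
Lemma cimg_open c : (0 < m)%N -> A c -> open (cimg c).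
Proof.
move=> m0 Ac; have [_ _ /(_ _ Ac) [_ [V oV cV] _ _ _] _ _] := mfd.
pose i : 'I_m := Ordinal m0.
have -> : cimg c = V `&` [set x : 'rV[R]_m | 0 < x 0 i].
  apply/seteqP; split=> [z|z [Vz /= zi]].
    move=> cz; have := cz; rewrite {1}cV => -[Vz Hz]; split=> //=.
    rewrite lt_def Hz // andbT; apply/eqP => zi.
    have [s ds sz] := cz.
    have : bdry A s by exists c, i; rewrite sz.
    by rewrite no_bdry.
  rewrite cV; split=> // j j0.
  by have -> : j = i by [apply: val_inj]; rewrite ltW.
apply: openI => //.
rewrite (_ : [set _ | _] = (fun x : 'rV[R]_m => x 0 i) @^-1` [set r | 0 < r]) //.
apply: open_comp; last exact: open_gt.
by move=> x _; exact: coord_continuous.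
Qed.

Lemma continuous_sqnorm_immersion n (F : S -> 'rV[R]_n) : (0 < m)%N ->
  (forall c, A c -> smooth_mx_on (cimg c) (F \o cinv c)) ->
  continuous (fun s => sqnorm (F s)).
Proof.
move=> m0 sF s; have [_ _ charts /(_ s) [c Ac cs] _] := mfd.
have [od _ cK cc _] := charts _ Ac.
pose f z := sqnorm (F (cinv c z)).
have cf : {for cmap c s, continuous f}.
  apply: differentiable_continuous.
  have -> : f = \sum_k (fun z => (F \o cinv c) z 0 k * (F \o cinv c) z 0 k).
    by apply/funext => z; rewrite fct_sumE.
  apply: differentiable_sum => k; have cimgs : cimg c (cmap c s) by exists s.
  have d := smooth_on_open (cimg_open m0 Ac) (sF c Ac 0 k) [::] cimgs.
  exact: differentiableM.
have cs' : {for s, continuous (cmap c)}.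
  move: cc; rewrite (continuous_open_subspace (cmap c) od); apply; exact: mem_set.
have fs : f (cmap c s) = sqnorm (F s) by rewrite /f cK.
have h : f (cmap c t) @[t --> s] --> sqnorm (F s).
  by rewrite -fs; exact: continuous_comp.
apply: cvg_trans h; apply: near_eq_cvg.
have : nbhs s (cdom c) by apply: open_nbhs_nbhs.
by apply: filterS => t ct; rewrite /f cK.
Qed.

End ClosedHypersurface.

Unset Implicit Arguments.

Theorem mainTheorem3 (R : realType) (n : nat) (hn : (3 <= n)%N)
  (g0 : 'rV[R]_n -> 'M[R]_n) (hg : riemannian_metric g0)
  (hcomplete : complete_metric g0)
  (hAH : conformally_compact_AH g0)
  (hrot : rotationally_symmetric g0)
  (lam : 'rV[R]_n -> R) (hlam : orbit_curvature g0 lam)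
  (hneg : forall x, lam x <= 0) :
  ~ exists (S : topologicalType) (A : set (chart R n.-1 S)) (F : S -> 'rV[R]_n),
      closed_minimal_hypersurface g0 A F.
Proof.
move=> [S [A [F [mfd [Sc nb [s0 _]] sF rF mF]]]].
have m0 : (0 < n.-1)%N by case: n hn {g0 hg hcomplete hAH hrot lam hlam hneg A F mfd Sc nb s0 sF rF mF} => [|[|]].
have [s _ smax] := compact_EVT_max (ex_intro _ s0 I) Sc
  (continuous_subspaceT (continuous_sqnorm_immersion mfd nb m0 sF)).
have [_ _ charts /(_ s) [c Ac cs] _] := mfd.
have [_ _ cK _ _] := charts _ Ac.
have cy : cimg c (cmap c s) by exists s.
have oc := cimg_open mfd nb m0 Ac.
have ymax z : cimg c z ->
    sqnorm ((F \o cinv c) z) <= sqnorm ((F \o cinv c) (cmap c s)).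
  by move=> _; rewrite /= cK //; exact: smax (mem_set I).
have x0 := max_point_neq0 oc cy (sF c Ac) ymax (rF c _ Ac cy) m0.
pose i0 : 'I_n := Ordinal (ltn_trans (isT : 0 < 2)%N hn).
pose i1 : 'I_n := Ordinal (ltn_trans (isT : 1 < 2)%N hn).
pose i2 : 'I_n := Ordinal hn.
have [gs gp] := hg.
have curv r : 0 < r -> sectional_curvature g0 (r *: delta_mx 0 i0)
    (delta_mx 0 i1) (delta_mx 0 i2) <= 0.
  move=> r0; have [_ <-] := hlam; first exact: hneg.
  - exact: orbit_tangent_axis (lt0r_neq0 r0) _.
  - exact: orbit_tangent_axis (lt0r_neq0 r0) _.
  - exact: row_free_delta.
have [p [q [k [p0 q0 k1 [gtan gx Gx]]]]] :=
  spheres_mean_convex gs gp hrot (isT : i0 != i1) (isT : i0 != i2)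
    (isT : i1 != i2) curv x0.
apply: (no_minimal_touching oc cy (sF c Ac) ymax (rF c _ Ac cy) m0 p0 q0 k1 gtan gx Gx).
by move=> nu; exact: mF.
Qed.
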